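(* Let $r$ and $s$ be integers with $r\geq 3$ and $2\leq s\leq r$, and let $\gamma$ be a real number with $0\leq\gamma\leq\frac{r-2}{2(r-1)}$. If $G$ is an $n$-vertex $K_{r}$-free graph with at least $\gamma n^{2}$ edges, then the $K_{s}$-independence number of $G$ is at most $\left(\frac{s-1}{r-1}+d_{r,\gamma}(s)\right)n$.
   Context: Graphs are finite and simple. The $K_s$-independence number of a graph $G$ is the maximum order (number of vertices) of an induced $K_s$-free subgraph of $G$. For an integer $r\ge 3$, a real number $0\le\gamma\le\frac{r-2}{2(r-1)}$ and an integer $s$ with $2\le s\le r$, define \[d_{r,\gamma}(s):=\sqrt{\frac{2(s-1)(r-s)}{r-1}\left(\frac{r-2}{2(r-1)}-\gamma\right)}.\] *)

(* Defs.v *)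
From mathcomp Require Import all_boot all_order all_algebra.
From mathcomp Require Import reals.

Set Implicit Arguments.
Unset Strict Implicit.
Unset Printing Implicit Defensive.

Import Order.TTheory GRing.Theory Num.Theory.

Record simple_graph (T : finType) := SimpleGraph {
  adj :> rel T;
  adj_sym : symmetric adj;
  adj_irrefl : irreflexive adj
}.

Definition edges (T : finType) (G : simple_graph T) : {set {set T}} :=
  [set [set x; y] | x in T, y in T & G x y].

Definition clique (T : finType) (G : simple_graph T) (K : {set T}) : bool :=
  [forall x in K, forall y in K, (x != y) ==> G x y].

Definition K_free (T : finType) (s : nat) (G : simple_graph T) : bool :=
  [forall K : {set T}, clique G K ==> (#|K| != s)].

Definition induced (T : finType) (G : simple_graph T) (A : {set T}) :
  simple_graph {x : T | x \in A} :=
  @SimpleGraph _ (fun u v => G (val u) (val v))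
    (fun u v => adj_sym G (val u) (val v))
    (fun u => adj_irrefl G (val u)).

Definition K_independence_number
    (T : finType) (s : nat) (G : simple_graph T) : nat :=
  \max_(A : {set T} | K_free s (induced G A)) #|A|.

Local Open Scope ring_scope.

Definition d (R : realType) (r : nat) (gamma : R) (s : nat) : R :=
  Num.sqrt (2 * (s%:R - 1) * (r%:R - s%:R) / (r%:R - 1)
            * ((r%:R - 2) / (2 * (r%:R - 1)) - gamma)).

(* Main.v *)
(** Write [a] for the order of a [K_s]-free induced subgraph on [A]. A
Motzkin-Straus argument bounds the quadratic form of [G] plus a linear form:
if the squares of the weights [c] sum to at most [M] over every clique, then
[sum_(x ~ y) z x z y + 2 sum_x c x z x <= (sum_x z x)^2 + M] for all [z >= 0],
because moving mass between two non-adjacent vertices changes the left-hand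
side affinely, so that one may assume the support of [z] to be a clique.
If [s < r] and [a / (s - 1) >= (n - a) / (r - s)], take [z = 1], with
[c = a / (s - 1)] on [A] and [c = (n - a) / (r - s)] off [A]: this gives
[2 e(G) <= n^2 - a^2 / (s - 1) - (n - a)^2 / (r - s)], which is the claimed
bound after completing the square. *)
Require Import Defs.
From mathcomp Require Import all_boot all_order all_algebra.
From mathcomp Require Import reals.
From mathcomp Require Import ring lra.

Set Implicit Arguments.
Unset Strict Implicit.
Unset Printing Implicit Defensive.

Import Order.TTheory GRing.Theory Num.Theory.
Local Open Scope ring_scope.

Lemma sub_clique (T : finType) (G : simple_graph T) (K L : {set T}) :
  L \subset K -> clique G K -> clique G L.
Proof.
move=> /subsetP LK /forall_inP cK; apply/forall_inP => x xL.
by apply/forall_inP => y yL; apply: (forall_inP (cK _ (LK _ xL))); apply: LK.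
Qed.

(** [K_free] excludes only cliques of order exactly [s]; a larger clique would contain one of that
    order. *)
Lemma clique_card_lt (T : finType) (s : nat) (G : simple_graph T)
  (K : {set T}) : K_free s G -> clique G K -> (#|K| < s)%N.
Proof.
move=> /forallP Gs cK; rewrite ltnNge; apply/negP => /card_geqP[q [uq qs qK]].
have /implyP/(_ _)/eqP[] := Gs [set x in q].
  by apply: sub_clique cK; apply/subsetP => x; rewrite inE; apply: qK.
by rewrite cardsE (card_uniqP uq).
Qed.

Lemma clique_cardI_lt (T : finType) (s : nat) (G : simple_graph T)
  (A K : {set T}) :
  K_free s (induced G A) -> clique G K -> (#|K :&: A| < s)%N.
Proof.
move=> GAs cK; pose L := [set u : {x | x \in A} | val u \in K].
have -> : K :&: A = val @: L.
  apply/setP => x; apply/setIP/imsetP => [[xK xA]|[u + ->]].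
    by exists (Sub x xA); rewrite ?inE.
  by rewrite inE; split=> //; apply: valP.
rewrite card_imset; last exact: val_inj.
apply: clique_card_lt GAs _; apply/forall_inP => u; rewrite inE => uK.
apply/forall_inP => v; rewrite inE => vK.
by rewrite -(inj_eq val_inj); apply: (forall_inP (forall_inP cK _ uK)).
Qed.

(** Each edge is the image of two distinct ordered adjacent pairs, [(x, y)] and [(y, x)]. *)
Lemma handshake_le (T : finType) (G : simple_graph T) :
  (2 * #|edges G| <= \sum_x \sum_y G x y)%N.
Proof.
pose D := [set p : T * T | G p.1 p.2].
have -> : (\sum_x \sum_y G x y = #|D|)%N.
  rewrite pair_bigA /= -sum1_card [RHS]big_mkcond /=; apply: eq_bigr => p _.
  by rewrite inE; case: (G _ _).
pose f (p : T * T) := [set p.1; p.2].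
have fD : edges G \subset f @: D.
  apply/subsetP => e /imset2P[x y _]; rewrite !inE /= => Gxy ->.
  by apply/imsetP; exists (x, y); rewrite ?inE.
rewrite -[#|D|]sum1_card (partition_big_imset f) /= mulnC -sum_nat_const.
rewrite [leqRHS](big_setID (edges G)) /= (setIidPr fD).
apply: leq_trans (leq_addr _ _); apply: leq_sum => e.
case/imset2P => x y _; rewrite !inE /= => Gxy ->.
have xy : (x, y) != (y, x).
  by apply/eqP => -[xy _]; move: Gxy; rewrite xy adj_irrefl.
rewrite sum1dep_card -[2%N]/(true.+1) -xy -cards2 subset_leq_card //.
apply/subsetP => p; rewrite !inE => /orP[]/eqP->; rewrite /f /= ?eqxx ?andbT //.
by rewrite adj_sym Gxy setUC eqxx.
Qed.

Section MotzkinStraus.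
Variables (R : realFieldType) (T : finType) (G : simple_graph T) (c : T -> R).

Definition edge_form (z : T -> R) : R :=
  \sum_x \sum_y (G x y)%:R * (z x * z y) + 2 * \sum_x c x * z x.

(** On a clique only the diagonal is missing from the quadratic part, which is therefore
    [(sum z)^2 - sum z^2]; the slack is then the sum of [(c x - z x)^2] over [K]. *)
Lemma edge_form_clique (z : T -> R) (K : {set T}) :
  clique G K -> (forall x, x \notin K -> z x = 0) ->
  edge_form z <= (\sum_x z x) ^+ 2 + \sum_(x in K) c x ^+ 2.
Proof.
move=> cK zK.
have quadE : \sum_x \sum_y (G x y)%:R * (z x * z y)
    = (\sum_x z x) ^+ 2 - \sum_(x in K) z x ^+ 2.
  have -> : \sum_(x in K) z x ^+ 2 = \sum_x z x ^+ 2.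
    rewrite big_mkcond /=; apply: eq_bigr => x _.
    by case: ifPn => // /zK ->; rewrite expr0n.
  rewrite expr2 mulr_suml -sumrB; apply: eq_bigr => x _.
  rewrite mulr_sumr (bigD1 x) //= [in RHS](bigD1 x) //= adj_irrefl mul0r add0r.
  rewrite expr2 addrC addrK; apply: eq_bigr => y yx.
  have [xK|/zK->] := boolP (x \in K); last by rewrite mul0r mulr0.
  have [yK|/zK->] := boolP (y \in K); last by rewrite !mulr0.
  by rewrite (implyP (forall_inP (forall_inP cK _ xK) _ yK)) ?mul1r // eq_sym.
have linE : \sum_x c x * z x = \sum_(x in K) c x * z x.
  rewrite [RHS]big_mkcond /=; apply: eq_bigr => x _.
  by case: ifPn => // /zK ->; rewrite mulr0.
have : 0 <= \sum_(x in K) (c x - z x) ^+ 2.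
  by apply: sumr_ge0 => x _; apply: sqr_ge0.
under eq_bigr => x _ do rewrite sqrrB mulr2n.
rewrite !big_split /= sumrN big_split /= /edge_form quadE linE; lra.
Qed.

Definition shift (u v : T) (t : R) (z : T -> R) (x : T) : R :=
  z x + t * ((x == u)%:R - (x == v)%:R).

Lemma sum_indicator (u : T) (F : T -> R) : \sum_x (x == u)%:R * F x = F u.
Proof.
by rewrite (bigD1 u) //= eqxx mul1r big1 ?addr0 // => x /negPf->; rewrite mul0r.
Qed.

Lemma sum_shift (u v : T) (t : R) (z F : T -> R) :
  \sum_x F x * shift u v t z x = \sum_x F x * z x + t * (F u - F v).
Proof.
rewrite -(sum_indicator u F) -(sum_indicator v F) -sumrB mulr_sumr -big_split.
by apply: eq_bigr => x _; rewrite /shift /=; ring.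
Qed.

Lemma sum1_shift (u v : T) (t : R) (z : T -> R) :
  \sum_x shift u v t z x = \sum_x z x.
Proof.
have := sum_shift u v t z (fun=> 1); rewrite subrr mulr0 addr0.
by under eq_bigr do rewrite mul1r; under [RHS]eq_bigr do rewrite mul1r.
Qed.

(** For non-adjacent [u] and [v], the derivative of [edge_form] when mass moves from [v] to [u]. *)
Definition slope (u v : T) (z : T -> R) : R :=
  2 * (\sum_y (G u y)%:R * z y - \sum_y (G v y)%:R * z y + (c u - c v)).

(** The coefficient of [t^2] only involves the entries of the adjacency matrix at [u] and [v], all
    zero since there are no loops and [u], [v] are non-adjacent. *)
Lemma edge_form_shift (u v : T) (t : R) (z : T -> R) :
  ~~ G u v -> edge_form (shift u v t z) = edge_form z + t * slope u v z.
Proof.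
move=> Guv.
pose N (w : T -> R) x := \sum_y (G x y)%:R * w y.
have NE (w : T -> R) :
    \sum_x \sum_y (G x y)%:R * (w x * w y) = \sum_x N w x * w x.
  apply: eq_bigr => x _; rewrite mulr_suml; apply: eq_bigr => y _; ring.
have Nsym x : \sum_y (G y x)%:R * z y = N z x.
  by apply: eq_bigr => y _; rewrite adj_sym.
have Gvu : ~~ G v u by rewrite adj_sym.
have Nsh x : N (shift u v t z) x = N z x + t * ((G x u)%:R - (G x v)%:R).
  exact: sum_shift.
rewrite /edge_form !NE !sum_shift !Nsh !adj_irrefl (negPf Guv) (negPf Gvu).
have -> : \sum_x N (shift u v t z) x * z x
    = \sum_x N z x * z x + t * (N z u - N z v).
  rewrite -!Nsym -sumrB mulr_sumr -big_split /=; apply: eq_bigr => x _.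
  by rewrite Nsh; ring.
rewrite /slope -/(N z u) -/(N z v); ring.
Qed.

Lemma Motzkin_Straus_le (M : R) (z : T -> R) :
  (forall K : {set T}, clique G K -> \sum_(x in K) c x ^+ 2 <= M) ->
  (forall x, 0 <= z x) -> edge_form z <= (\sum_x z x) ^+ 2 + M.
Proof.
move=> cM.
(* Induction on the size of the support of [z]. *)
have [k] := ubnP #|[set x | z x != 0]|; elim: k => // k IH in z *.
move=> zk z0; set K := [set x | z x != 0] in zk.
have [cK|] := boolP (clique G K).
  apply: le_trans (edge_form_clique cK _) _; last by rewrite lerD2l cM.
  by move=> x; rewrite inE negbK => /eqP.
case/forall_inPn => u uK /forall_inPn[v vK]; rewrite negb_imply => /andP[uv Guv].
(* By symmetry, moving the mass of [v] to [u] does not decrease the form. *)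
wlog sl : u v uK vK uv Guv / 0 <= slope u v z.
  move=> H; have slC : slope v u z = - slope u v z by rewrite /slope; ring.
  have [sl|/ltW sl] := leP 0 (slope u v z); first exact: (H u v).
  by apply: (H v u); rewrite // 1?eq_sym 1?adj_sym // slC oppr_ge0.
(* Moving all of the mass removes [v] from the support and adds nothing, as [u] already lies in
   it. *)
pose z' := shift u v (z v) z.
have z'v : z' v = 0.
  by rewrite /z' /shift eqxx eq_sym (negPf uv) sub0r mulrN1 subrr.
have zz : edge_form z <= edge_form z'.
  by rewrite edge_form_shift // lerDl mulr_ge0.
apply: le_trans zz _; rewrite -(sum1_shift u v (z v)); apply: IH => [|x].
  rewrite -ltnS; apply: leq_trans zk; rewrite ltnS; apply: proper_card.
  apply/properP; split; last by exists v; rewrite // inE z'v eqxx.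
  apply/subsetP => x; rewrite !inE; apply: contra_neq => zx.
  have [->//|xv] := eqVneq x v.
  have [xu|xu] := eqVneq x u; first by move: uK; rewrite inE -xu zx eqxx.
  by rewrite /z' /shift (negPf xv) (negPf xu) zx subrr mulr0 addr0.
have [->|xv] := eqVneq x v; first by rewrite z'v.
by rewrite /z' /shift (negPf xv) subr0 addr_ge0 // mulr_ge0.
Qed.

End MotzkinStraus.

(** Here [p] and [q] stand for [s - 1] and [r - s]. The last hypothesis says that the weight on [A]
    is at least the weight off [A], so the worst clique has [p] vertices in [A] and [q] outside. *)
Lemma edges_le (R : realFieldType) (p q : nat) (T : finType)
  (G : simple_graph T) (A : {set T}) :
  (0 < p)%N -> (0 < q)%N -> K_free (p + q).+1 G -> K_free p.+1 (induced G A) ->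
  let a : R := #|A|%:R in let n : R := #|T|%:R in
  n * p%:R <= a * (p + q)%:R ->
  2 * #|edges G|%:R <= n ^+ 2 - a ^+ 2 / p%:R - (n - a) ^+ 2 / q%:R.
Proof.
move=> p0 q0 Gr GA a n na.
have p0R : 0 < p%:R :> R by rewrite ltr0n.
have q0R : 0 < q%:R :> R by rewrite ltr0n.
have an : a <= n by rewrite ler_nat max_card.
have cardCA : #|~: A|%:R = n - a by rewrite /n /a -(cardsC A) natrD addrAC subrr add0r.
pose cA := a / p%:R; pose cB := (n - a) / q%:R.
pose c x := if x \in A then cA else cB.
have cB0 : 0 <= cB by rewrite divr_ge0 ?subr_ge0 ?ler0n.
have cBA : cB <= cA.
  by rewrite ler_pdivrMr // /cA mulrAC ler_pdivlMr //; move: na; rewrite natrD; lra.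
have sumc (B : {set T}) (f : R -> R) :
    \sum_(x in B) f (c x) = #|B :&: A|%:R * f cA + #|B :\: A|%:R * f cB.
  rewrite (big_setID A) /= !mulr_natl -!sumr_const.
  congr (_ + _); apply: eq_bigr => x; rewrite !inE /c => /andP[].
    by move=> _ ->.
  by move=> /negPf->.
have cM (K : {set T}) : clique G K ->
    \sum_(x in K) c x ^+ 2 <= p%:R * cA ^+ 2 + q%:R * cB ^+ 2.
  move=> cK; rewrite (sumc K (fun y => y ^+ 2)).
  have := clique_cardI_lt GA cK; rewrite ltnS -(ler_nat R) => Kp.
  have := clique_card_lt Gr cK; rewrite ltnS -(cardsID A) -(ler_nat R) !natrD.
  have sq : cB ^+ 2 <= cA ^+ 2 by rewrite ler_pXn2r // nnegrE // (le_trans cB0).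
  have sq0 := sqr_ge0 cB.
  move: Kp; move: (#|K :&: A|%:R) (#|K :\: A|%:R) => i j Kp Kpq.
  (* Exchange vertices off [A] for vertices of [A], where [c] is larger. *)
  have h1 : 0 <= (p%:R - i) * (cA ^+ 2 - cB ^+ 2) by rewrite mulr_ge0 ?subr_ge0.
  have h2 : 0 <= (p%:R + q%:R - (i + j)) * cB ^+ 2 by rewrite mulr_ge0 ?subr_ge0.
  lra.
have := @Motzkin_Straus_le _ _ _ _ _ (fun=> 1) cM (fun=> ler01).
rewrite /edge_form sumr_const -/n.
have -> : \sum_x c x * 1 = a * cA + (n - a) * cB.
  under eq_bigr do rewrite mulr1.
  rewrite (eq_bigl (mem [set: T])) => [|x]; last exact/esym/in_setT.
  by rewrite (sumc [set: T] id) setTI setTD cardCA.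
have -> : \sum_x \sum_y (G x y)%:R * (1 * 1) = (\sum_x \sum_y G x y)%:R :> R.
  rewrite natr_sum; apply: eq_bigr => x _; rewrite natr_sum.
  by apply: eq_bigr => y _; rewrite !mulr1.
have := handshake_le G; rewrite -(ler_nat R) natrM => hs.
have -> : a * cA = a ^+ 2 / p%:R by rewrite /cA; ring.
have -> : (n - a) * cB = (n - a) ^+ 2 / q%:R by rewrite /cB; ring.
(* The clique bound thus equals the total weight [sum_x c x], so it cancels one of the two copies in
   the linear term. *)
have -> : p%:R * cA ^+ 2 = a ^+ 2 / p%:R by rewrite /cA; field; lra.
have -> : q%:R * cB ^+ 2 = (n - a) ^+ 2 / q%:R by rewrite /cB; field; lra.
by rewrite -/n; lra.
Qed.

Theorem theorem1p5 (R : realType) (r s : nat) (gamma : R)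
    (hr : (3 <= r)%N) (hs : (2 <= s <= r)%N)
    (hgamma : 0 <= gamma <= (r%:R - 2) / (2 * (r%:R - 1)))
    (n : nat) (T : finType) (G : simple_graph T)
    (hn : #|T| = n)
    (hfree : K_free r G)
    (hedges : gamma * n%:R ^+ 2 <= #|edges G|%:R) :
  (K_independence_number s G)%:R
    <= ((s%:R - 1) / (r%:R - 1) + d r gamma s) * n%:R.
Proof.
subst n; set n : R := #|T|%:R in hedges *.
have n0 : 0 <= n by apply: ler0n.
have d0 : 0 <= d r gamma s by apply: sqrtr_ge0.
case/andP: hs => s2 sr.
have r3R : 3 <= r%:R :> R by rewrite ler_nat.
have s2R : 2 <= s%:R :> R by rewrite ler_nat.
have ratio0 : 0 <= (s%:R - 1) / (r%:R - 1) :> R by rewrite divr_ge0; lra.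
have rhs0 : 0 <= ((s%:R - 1) / (r%:R - 1) + d r gamma s) * n.
  by rewrite mulr_ge0 // addr_ge0.
rewrite /K_independence_number.
elim/big_ind: _ => [//|x y xB yB|A GA]; first by rewrite /maxn; case: ifP.
set a : R := #|A|%:R.
have an : a <= n by rewrite ler_nat max_card.
(* For [s = r] the ratio is 1 and [a <= n] is enough; [edges_le] requires [r - s > 0]. *)
have [ltsr|] := ltnP s r; last first.
  move=> rs; have <- : s = r by apply/eqP; rewrite eqn_leq sr.
  rewrite divff; last lra.
  apply: le_trans an _; rewrite mulrDl mul1r lerDl mulr_ge0 //; exact: sqrtr_ge0.
have srR : s%:R < r%:R :> R by rewrite ltr_nat.
rewrite mulrDl -lerBlDl.
(* Below the threshold the left side is nonpositive; above it, [large] is the weight comparison that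
   [edges_le] asks for. *)
have [small|/ltW large] := leP a ((s%:R - 1) / (r%:R - 1) * n).
  by apply: (@le_trans _ _ 0); rewrite ?subr_le0 ?mulr_ge0.
have pE : s.-1%:R = s%:R - 1 :> R by rewrite -subn1 natrB // ltnW.
have qE : (r - s)%:R = r%:R - s%:R :> R by rewrite natrB.
have pqE : (s.-1 + (r - s)).+1 = r by rewrite -addSn prednK ?subnKC // ltnW.
have p0 : (0 < s.-1)%N by rewrite -ltnS prednK // ltnW.
have q0 : (0 < r - s)%N by rewrite subn_gt0.
have := @edges_le R s.-1 (r - s) T G A p0 q0.
rewrite pqE prednK ?(ltnW s2) // natrD pE qE -/a -/n => /(_ hfree GA) edgesP.
have edgesB : 2 * #|edges G|%:R <=
    n ^+ 2 - a ^+ 2 / (s%:R - 1) - (n - a) ^+ 2 / (r%:R - s%:R).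
  apply: edgesP; move: large; rewrite mulrAC ler_pdivrMr; lra.
have excess0 : 0 <= a - (s%:R - 1) / (r%:R - 1) * n by rewrite subr_ge0.
rewrite -ler_sqr ?nnegrE ?mulr_ge0 //.
rewrite exprMn /d sqr_sqrtr; last first.
  case/andP: hgamma => _; rewrite -subr_ge0 => g.
  by rewrite mulr_ge0 // divr_ge0 ?mulr_ge0 //; lra.
have k0 : 0 <= (s%:R - 1) * (r%:R - s%:R) / (r%:R - 1) :> R.
  by rewrite divr_ge0 ?mulr_ge0 //; lra.
(* The factor is the inverse of [1 / (s - 1) + 1 / (r - s)], which makes the coefficient of [a^2]
   equal to -1. The difference of the two sides is then exactly that of the squared goal. *)
have : (s%:R - 1) * (r%:R - s%:R) / (r%:R - 1) * (2 * (gamma * n ^+ 2)) <=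
  (s%:R - 1) * (r%:R - s%:R) / (r%:R - 1) *
  (n ^+ 2 - a ^+ 2 / (s%:R - 1) - (n - a) ^+ 2 / (r%:R - s%:R)).
  by rewrite ler_wpM2l //; lra.
move=> h; rewrite -subr_ge0 in h; rewrite -subr_ge0; apply: le_trans h _.
rewrite le_eqVlt; apply/predU1P; left.
by field; apply/and3P; split; lra.
Qed.
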